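(* Let $\mu$ be a finite topological measure on a locally compact space $X$, and let $f\in C_0(X)$. Then the right measure $r$ and the left measure $l$ determined by $\mu$ and $f$ satisfy $r=l$.
   Context: $X$ is a locally compact Hausdorff connected space; $\mathscr{O}(X),\mathscr{C}(X),\mathscr{K}(X)$ are the families of open, closed, compact subsets; $C_0(X)$ is the set of real continuous functions vanishing at infinity. A topological measure on $X$ is $\mu:\mathscr{C}(X)\cup\mathscr{O}(X)\to[0,\infty]$ such that: if $A,B,A\sqcup B\in\mathscr{K}(X)\cup\mathscr{O}(X)$ (disjoint union) then $\mu(A\sqcup B)=\mu(A)+\mu(B)$; $\mu(U)=\sup\{\mu(K): K\in\mathscr{K}(X), K\subseteq U\}$ for open $U$; $\mu(F)=\inf\{\mu(U): F\subseteq U\in\mathscr{O}(X)\}$ for closed $F$. It is finite if $\mu(X)<\infty$. Put $L_1(t)=\mu(f^{-1}((-\infty,t)))$ and $R_1(t)=\mu(f^{-1}((t,\infty)))$, $t\in\mathbb{R}$. The left measure $l$ is the Lebesgue–Stieltjes measure on $\mathbb{R}$ associated with the non-decreasing left-continuous function $L_1$; the right measure $r$ is the Lebesgue–Stieltjes measure associated with the non-decreasing right-continuous function $-R_1$. *)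

(* Defs.v *)
From HB Require Import structures.
From mathcomp Require Import all_boot all_order all_algebra.
From mathcomp Require Import all_classical all_reals all_analysis.

Set Implicit Arguments.
Unset Strict Implicit.
Unset Printing Implicit Defensive.
Import Order.TTheory GRing.Theory Num.Theory.
Import numFieldNormedType.Exports.
Local Open Scope classical_set_scope.
Local Open Scope ring_scope.

Record C0 (R : realType) (X : topologicalType) := MkC0 {
  C0_fun :> X -> R ;
  C0_continuous : continuous C0_fun ;
  C0_vanishing : forall e : R, 0 < e -> compact [set x | e <= `|C0_fun x|] }.

Definition compact_or_open (X : topologicalType) : set (set X) :=
  [set A | compact A \/ open A].

(* A topological measure lives on the open and closed sets only: the function
   below is defined on all sets, but nothing is assumed (and nothing is ever
   used) about its values on sets that are neither open nor closed.  Compact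
   sets are closed when X is Hausdorff. *)
Record topological_measure (R : realType) (X : topologicalType) :=
  MkTopologicalMeasure {
  tm_fun :> set X -> \bar R ;
  tm_ge0 : forall A, closed A \/ open A -> (0 <= tm_fun A)%E ;
  tm_additive : forall A B, compact_or_open A -> compact_or_open B ->
    compact_or_open (A `|` B) -> A `&` B = set0 ->
    tm_fun (A `|` B) = (tm_fun A + tm_fun B)%E ;
  tm_inner : forall U, open U ->
    tm_fun U = ereal_sup [set tm_fun K | K in [set K | compact K /\ K `<=` U]] ;
  tm_outer : forall F, closed F ->
    tm_fun F = ereal_inf [set tm_fun U | U in [set U | open U /\ F `<=` U]] }.

Record finite_topological_measure (R : realType) (X : topologicalType) :=
  MkFiniteTopologicalMeasure {
  ftm_tm :> topological_measure R X ;
  ftm_finite : (ftm_tm setT < +oo)%E }.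

Definition left_continuous (R : realType) (F : R -> R) :=
  forall x, F @ at_left x --> F x.

Record left_cumulative (R : realType) := MkLeftCumulative {
  left_cumulative_fun :> R -> R ;
  left_cumulative_nondecreasing :
    {homo left_cumulative_fun : x y / (x <= y)%R} ;
  left_cumulative_left_continuous : left_continuous left_cumulative_fun }.

Section left_lebesgue_stieltjes.
Context {R : realType}.
Variable F : left_cumulative R.

Definition reflection (x : R) : R := - F (- x).

Let reflection_nd : nondecreasing reflection.
Proof.
by move=> x y xy; rewrite /reflection lerN2 left_cumulative_nondecreasing// lerN2.
Qed.

Let reflection_rc : right_continuous reflection.
Proof.
move=> x; rewrite /reflection; apply: cvgN.
have := @left_cumulative_left_continuous _ F (- x).
by rewrite cvg_at_leftNP opprK.
Qed.

HB.instance Definition _ :=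
  isCumulative.Build R _ R reflection reflection_nd reflection_rc.

(* [lebesgue_stieltjes_measure] takes a right-continuous function G and is
   normalised by ]a, b] |-> G b - G a.  For a left-continuous F the measure has
   to be normalised by [a, b[ |-> F b - F a, and it is obtained as the image
   under x |-> - x of the measure of the right-continuous x |-> - F (- x);
   see [left_lebesgue_stieltjes_itvco] and [left_lebesgue_stieltjes_unique]. *)
Definition left_lebesgue_stieltjes_measure : set (measurableTypeR R) -> \bar R :=
  pushforward (lebesgue_stieltjes_measure reflection)
    (-%R : measurableTypeR R -> measurableTypeR R).

Let measurable_opp : measurable_fun [set: measurableTypeR R]
  (-%R : measurableTypeR R -> measurableTypeR R).
Proof. exact: measurable_realfun.oppr_measurable. Qed.

Let lls0 : left_lebesgue_stieltjes_measure set0 = 0%E.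
Proof. by rewrite /left_lebesgue_stieltjes_measure /pushforward measure0. Qed.

Let lls_ge0 A : (0 <= left_lebesgue_stieltjes_measure A)%E.
Proof. exact: measure_ge0. Qed.

Let lls_sigma_additive : semi_sigma_additive left_lebesgue_stieltjes_measure.
Proof.
apply: (@measure_semi_sigma_additive _ _ _
  (pushforward (lebesgue_stieltjes_measure reflection) _)).
exact: measurable_opp.
Qed.

HB.instance Definition _ := isMeasure.Build _ _ _
  left_lebesgue_stieltjes_measure lls0 lls_ge0 lls_sigma_additive.

Lemma left_lebesgue_stieltjes_itvco (a b : R) : a <= b ->
  left_lebesgue_stieltjes_measure `[a, b[%classic = (F b - F a)%:E.
Proof.
move=> ab; rewrite /left_lebesgue_stieltjes_measure /pushforward.
rewrite (_ : _ @^-1` _ = `]- b, - a]%classic); last first.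
  exact: opp_preimage_itvbndbnd.
rewrite /lebesgue_stieltjes_measure /measure_extension.
rewrite measurable_mu_extE/=; last exact: is_ocitv.
by rewrite wlength_itv_bnd ?lerN2// /reflection !opprK addrC.
Qed.

Lemma left_lebesgue_stieltjes_unique
    (nu : {measure set (measurableTypeR R) -> \bar R}) :
    (forall a b : R, a <= b -> nu `[a, b[%classic = (F b - F a)%:E) ->
  forall A : set R, measurable A -> left_lebesgue_stieltjes_measure A = nu A.
Proof.
move=> nuE A mA; rewrite /left_lebesgue_stieltjes_measure /pushforward.
have mNA : measurable ((-%R : R -> R) @^-1` A).
  by rewrite -[X in measurable X]setTI; exact: measurable_opp.
pose nuN := pushforward nu (-%R : measurableTypeR R -> measurableTypeR R).
rewrite (@lebesgue_stieltjes_measure_unique _ reflection nuN _ _ mNA).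
  rewrite /nuN /pushforward -comp_preimage.
  by congr (nu _); apply/seteqP; split => x /=; rewrite opprK.
move=> _ [[a b] _ <-].
rewrite [RHS](_ : _ = nu `[- b, - a[%classic); last first.
  by congr (nu _); exact: opp_preimage_itvbndbnd.
rewrite /lebesgue_stieltjes_measure /measure_extension.
rewrite measurable_mu_extE/=; last exact: is_ocitv.
have [ab|ba] := leP a b.
  by rewrite wlength_itv_bnd// nuE ?lerN2// /reflection opprK addrC.
by rewrite !set_itv_ge ?wlength0 ?measure0// bnd_simp -leNgt ?lerN2 ltW.
Qed.

End left_lebesgue_stieltjes.

Section left_right_measures.
Context {R : realType} {X : topologicalType}.
Variables (mu : finite_topological_measure R X) (f : C0 R X).

Definition L1 (t : R) : R := fine (mu (f @^-1` `]-oo, t[)).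

Definition R1 (t : R) : R := fine (mu (f @^-1` `]t, +oo[)).

Definition oppR1 (t : R) : R := - R1 t.

Let open_ray (i : interval R) : open [set` i] -> open (f @^-1` [set` i]).
Proof. by move=> oi; apply: open_comp => // x _; exact: C0_continuous. Qed.

Let mu_open_le (U V : set X) : open U -> open V -> U `<=` V ->
  (mu U <= mu V)%E.
Proof.
move=> oU oV UV; rewrite (tm_inner _ oU) (tm_inner _ oV).
apply: le_ereal_sup => _ [K [cK KU] <-]; exists K => //; split => //.
exact: subset_trans UV.
Qed.

Let mu_open_fin (U : set X) : open U -> mu U \is a fin_num.
Proof.
move=> oU; rewrite ge0_fin_numE; last by apply: tm_ge0; right.
by rewrite (le_lt_trans _ (ftm_finite mu))// mu_open_le//; exact: openT.
Qed.

Let fine_mu_open_le (U V : set X) : open U -> open V -> U `<=` V ->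
  fine (mu U) <= fine (mu V).
Proof. by move=> oU oV UV; rewrite fine_le ?mu_open_fin// mu_open_le. Qed.

Let mu_open_cvg (G : set_system R) (FG : Filter G) (U : R -> set X)
    (V : set X) : open V -> (forall s, open (U s)) ->
  (\forall s \near G, U s `<=` V) ->
  (forall K, compact K -> K `<=` V -> \forall s \near G, K `<=` U s) ->
  fine (mu (U s)) @[s --> G] --> fine (mu V).
Proof.
move=> oV oU UV KU; apply/cvgrPdist_lt => e e0.
have : ereal_sup [set mu K | K in [set K | compact K /\ K `<=` V]]
    \is a fin_num by rewrite -(tm_inner _ oV) mu_open_fin.
move=> /(ub_ereal_sup_adherent e0)[_ [K [cK KV] <-]].
rewrite -(tm_inner _ oV) => muK.
near=> s.
have sV : U s `<=` V by near: s.
have Ks : K `<=` U s by near: s; exact: KU.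
rewrite ger0_norm ?subr_ge0 ?fine_mu_open_le//.
have : (mu V - e%:E < mu (U s))%E.
  rewrite (lt_le_trans muK)// (tm_inner _ (oU s)).
  by apply: ereal_sup_ubound; exists K.
rewrite -(fineK (mu_open_fin oV)) -(fineK (mu_open_fin (oU s))).
by rewrite -EFinB lte_fin ltrBlDr addrC -ltrBlDr.
Unshelve. all: by end_near. Qed.

Let R1_rc : right_continuous oppR1.
Proof.
move=> t; rewrite /oppR1; apply: cvgN; apply: mu_open_cvg.
- by apply: open_ray; exact: rray_open.
- by move=> s; apply: open_ray; exact: rray_open.
- near=> s; move=> x /=; rewrite !in_itv/= !andbT; apply: lt_trans.
  by near: s; exact: nbhs_right_gt.
- move=> K /compact_near_coveringP cK KV; apply: cK => x Kx.
  have := KV _ Kx; rewrite /= in_itv/= andbT => tfx.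
  pose m := (t + f x) / 2.
  exists ([set y | m < f y], [set s | s < m]) => /=.
    split; last by apply: nbhs_right_lt; rewrite midf_lt.
    have : open (f @^-1` `]m, +oo[) by apply: open_ray; exact: rray_open.
    rewrite openE => /(_ x); rewrite /interior/= in_itv/= midf_lt//.
    move=> /(_ isT); apply: filterS => y /=.
    by rewrite in_itv/= andbT.
  by move=> [y s] [/= my sm]; rewrite in_itv/= andbT (lt_trans sm).
Unshelve. all: by end_near. Qed.

Let R1_nd : nondecreasing oppR1.
Proof.
move=> s t st; rewrite /oppR1 lerN2 fine_mu_open_le//; try exact/open_ray/rray_open.
by move=> x /=; rewrite !in_itv/= !andbT; exact: le_lt_trans.
Qed.

HB.instance Definition _ := isCumulative.Build R _ R oppR1 R1_nd R1_rc.

Definition right_measure : set (measurableTypeR R) -> \bar R :=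
  lebesgue_stieltjes_measure oppR1.

HB.instance Definition _ := Measure.on right_measure.

Let L1_lc : left_continuous L1.
Proof.
move=> t; apply: mu_open_cvg.
- by apply: open_ray; exact: lray_open.
- by move=> s; apply: open_ray; exact: lray_open.
- near=> s; move=> x /=; rewrite !in_itv/= => /lt_trans; apply.
  by near: s; exact: nbhs_left_lt.
- move=> K /compact_near_coveringP cK KV; apply: cK => x Kx.
  have := KV _ Kx; rewrite /= in_itv/= => fxt.
  pose m := (f x + t) / 2.
  exists ([set y | f y < m], [set s | m < s]) => /=.
    split; last by apply: nbhs_left_gt; rewrite midf_lt.
    have : open (f @^-1` `]-oo, m[) by apply: open_ray; exact: lray_open.
    rewrite openE => /(_ x); rewrite /interior/= in_itv/= midf_lt//.
    move=> /(_ isT); apply: filterS => y /=.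
    by rewrite in_itv/=.
  by move=> [y s] [/= ym ms]; rewrite in_itv/= (lt_trans ym).
Unshelve. all: by end_near. Qed.

Let L1_nd : {homo L1 : s t / s <= t}.
Proof.
move=> s t st; rewrite fine_mu_open_le//; try exact/open_ray/lray_open.
by move=> x /=; rewrite !in_itv/= => /lt_le_trans; apply.
Qed.

Definition L1_cumulative : left_cumulative R := MkLeftCumulative L1_nd L1_lc.

Definition left_measure : set (measurableTypeR R) -> \bar R :=
  left_lebesgue_stieltjes_measure L1_cumulative.

HB.instance Definition _ := Measure.on left_measure.

End left_right_measures.

(* Main.v *)
Require Import Defs.
From HB Require Import structures.
From mathcomp Require Import all_boot all_order all_algebra.
From mathcomp Require Import all_classical all_reals all_analysis.

Set Implicit Arguments.
Unset Strict Implicit.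
Unset Printing Implicit Defensive.
Import Order.TTheory GRing.Theory Num.Theory.
Import numFieldNormedType.Exports.
Local Open Scope classical_set_scope.
Local Open Scope ring_scope.

(** Let [m] be the total mass of [mu].  The sublevel set [f < s] and the
    superlevel set [t < f] are disjoint open sets when [s <= t], and they
    cover [X] when [t < s].  Additivity bounds [L1 s + R1 t] by [m] in the
    first case; in the second one [L1 s + R1 t >= m], but this is where [f]
    has to vanish at infinity: a topological measure is not subadditive, and
    one has to split [X] into an open set and a compact complement.  If
    [0 < s] the compact piece is [s <= f], and if [t < 0] it is [f <= t]; one
    of the two always happens (lemmas [L1D_R1_le] and [L1D_R1_ge]).

    Hence [m - R1 t <= L1 s <= m - R1 s] for [t < s], and the right continuity
    of [R1] gives [L1 s --> m - R1 t] as [s] decreases to [t]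
    (lemma [L1_at_right]): up to the constant [m], the function [- R1] is the
    right-continuous version of [L1].  Two such functions have the same
    Lebesgue-Stieltjes measure (lemma [left_lebesgue_stieltjesE]), since by
    continuity of measures the left one gives the interval [a < x <= b] the
    mass [L1 (b+) - L1 (a+)]. *)

Section left_lebesgue_stieltjes_theory.
Context {R : realType} (F : left_cumulative R).

(** The interval [a < x < b] is exhausted by the [a + 1/n <= x < b], whose
    masses are given by the normalisation of the measure. *)
Lemma left_lebesgue_stieltjes_itvoo (a b c : R) : a < b ->
  F x @[x --> a^'+] --> c ->
  left_lebesgue_stieltjes_measure F `]a, b[%classic = (F b - c)%:E.
Proof.
move=> ab Fac; pose u n : R := a + n.+1%:R^-1.
have ua : u n @[n --> \oo] --> a.
  rewrite -[X in _ --> X]addr0; apply: cvgD; first exact: cvg_cst.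
  exact: cvg_harmonic.
have Fu : F (u n) @[n --> \oo] --> c.
  by move/cvg_at_rightP : Fac; apply; split => // n; rewrite ltrDl.
have Eu : left_lebesgue_stieltjes_measure F `[u n, b[%classic @[n --> \oo]
    --> (F b - c)%:E.
  have : (F b - F (u n))%:E @[n --> \oo] --> (F b - c)%:E.
    by apply: cvg_EFin; [near=> n|apply: cvgB => //; exact: cvg_cst].
  apply: cvg_trans; apply: near_eq_cvg; near=> n.
  rewrite left_lebesgue_stieltjes_itvco// ltW//.
  by near: n; exact: (cvgr_lt a).
apply: (cvg_unique _ _ Eu) => //.
rewrite itv_open_bnd_bigcup; apply: nondecreasing_cvg_mu.
- by move=> n; exact: measurable_itv.
- by apply: bigcup_measurable => n _; exact: measurable_itv.
- move=> m n mn; apply/subsetPset; apply: subset_itvr.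
  by rewrite bnd_simp lerD2l lef_pV2 ?posrE// ler_nat.
Unshelve. all: by end_near. Qed.

Lemma left_lebesgue_stieltjes_itvoc (a b c d : R) : a <= b ->
  F x @[x --> a^'+] --> c -> F x @[x --> b^'+] --> d ->
  left_lebesgue_stieltjes_measure F `]a, b]%classic = (d - c)%:E.
Proof.
move=> ab Fac Fbd; have b1 : b < b + 1 by rewrite ltrDl.
have -> : `]a, b]%classic = `]a, b + 1[ `\` `]b, b + 1[.
  apply/seteqP; split => x /=; rewrite !in_itv/=.
    move=> /andP[-> xb]; rewrite (le_lt_trans xb b1)/=; split => //.
    by rewrite ltNge xb.
  by move=> [/andP[-> ->]] /negP; rewrite andbT -leNgt.
have Eac := left_lebesgue_stieltjes_itvoo (le_lt_trans ab b1) Fac.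
rewrite measureD//=; last by rewrite Eac ltry.
rewrite setIidr; last by apply: subset_itvr; rewrite bnd_simp.
rewrite Eac (left_lebesgue_stieltjes_itvoo b1 Fbd) -EFinB.
by rewrite opprB addrC addrA subrK.
Qed.

(** The measure only sees increments of one-sided limits, so [F] and its
    right-continuous version define the same one, and an additive constant
    disappears. *)
Lemma left_lebesgue_stieltjesE (G : cumulative R R) (k : R) :
  (forall t, F s @[s --> t^'+] --> k + G t) ->
  forall A : set R, measurable A ->
  lebesgue_stieltjes_measure G A = left_lebesgue_stieltjes_measure F A.
Proof.
move=> FG; apply: lebesgue_stieltjes_measure_unique => _ [[a b] _ <-].
have [ab|ba] := leP a b; last first.
  by rewrite set_itv_ge ?measure0// bnd_simp -leNgt ltW.
rewrite /= (left_lebesgue_stieltjes_itvoc ab (FG a) (FG b)).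
rewrite /lebesgue_stieltjes_measure /measure_extension.
rewrite measurable_mu_extE/=; last exact: is_ocitv.
by rewrite wlength_itv_bnd// opprD addrACA subrr add0r.
Qed.

End left_lebesgue_stieltjes_theory.

Section topological_measure_theory.
Context {R : realType} {X : topologicalType} (mu : topological_measure R X).

Lemma tm_compact_open_le (K U : set X) : compact K -> open U -> K `<=` U ->
  (mu K <= mu U)%E.
Proof.
by move=> cK oU KU; rewrite (tm_inner _ oU); apply: ereal_sup_ubound; exists K.
Qed.

Lemma tm_open_le (U V : set X) : open U -> open V -> U `<=` V ->
  (mu U <= mu V)%E.
Proof.
move=> oU oV UV; rewrite (tm_inner _ oU); apply: ge_ereal_sup.
move=> _ [K [cK KU] <-].
by apply: tm_compact_open_le => //; exact: subset_trans UV.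
Qed.

(** Although [mu] need not be subadditive, it is so on a pair of open sets
    covering [X] as soon as one complement is compact, because then [X] is the
    disjoint union of an open set and a compact set. *)
Lemma tm_setT_le (U V : set X) : open U -> open V -> compact (~` U) ->
  U `|` V = setT -> (mu setT <= mu U + mu V)%E.
Proof.
move=> oU oV cU UV; rewrite -(setUv U) tm_additive ?setICr//.
- rewrite leeD2l// tm_compact_open_le// => x Ux.
  by have : (U `|` V) x by [rewrite UV]; case.
- by right.
- by left.
- by right; rewrite setUv; exact: openT.
Qed.

End topological_measure_theory.

Section left_right_functions.
Context {R : realType} {X : topologicalType}.
Variables (mu : finite_topological_measure R X) (f : C0 R X).

Lemma ftm_open_fin_num (U : set X) : open U -> mu U \is a fin_num.
Proof.
move=> oU; rewrite ge0_fin_numE; last by apply: tm_ge0; right.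
by rewrite (le_lt_trans _ (ftm_finite mu))// tm_open_le//; exact: openT.
Qed.

Lemma open_C0_lt (t : R) : open (f @^-1` `]-oo, t[).
Proof.
by apply: open_comp => [x _|]; [exact: C0_continuous|exact: lray_open].
Qed.

Lemma open_C0_gt (t : R) : open (f @^-1` `]t, +oo[).
Proof.
by apply: open_comp => [x _|]; [exact: C0_continuous|exact: rray_open].
Qed.

Lemma compact_C0_ge (t : R) : 0 < t -> compact (~` (f @^-1` `]-oo, t[)).
Proof.
move=> t0; apply: subclosed_compact (@C0_vanishing _ _ f _ t0) _.
  by apply: open_closedC; exact: open_C0_lt.
move=> x /=; rewrite in_itv/= => /negP; rewrite -leNgt => /le_trans; apply.
exact: ler_norm.
Qed.

Lemma compact_C0_le (t : R) : t < 0 -> compact (~` (f @^-1` `]t, +oo[)).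
Proof.
rewrite -oppr_gt0 => t0; apply: subclosed_compact (@C0_vanishing _ _ f _ t0) _.
  by apply: open_closedC; exact: open_C0_gt.
move=> x /=; rewrite in_itv/= andbT => /negP; rewrite -leNgt -lerN2.
by move=> /le_trans; apply; rewrite ler_normr lexx orbT.
Qed.

Lemma EFin_L1D_R1 (s t : R) : (L1 mu f s + R1 mu f t)%:E =
  (mu (f @^-1` `]-oo, s[) + mu (f @^-1` `]t, +oo[))%E.
Proof.
by rewrite EFinD !fineK//; apply: ftm_open_fin_num; [exact: open_C0_gt|
  exact: open_C0_lt].
Qed.

Lemma EFin_ftm_setT : (fine (mu setT))%:E = mu setT.
Proof. by rewrite fineK// ftm_open_fin_num//; exact: openT. Qed.

Lemma L1D_R1_le (t : R) : L1 mu f t + R1 mu f t <= fine (mu setT).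
Proof.
have oU : open (f @^-1` `]-oo, t[ `|` f @^-1` `]t, +oo[).
  by apply: openU; [exact: open_C0_lt|exact: open_C0_gt].
rewrite -lee_fin EFin_L1D_R1 EFin_ftm_setT -tm_additive.
- by apply: tm_open_le => //; exact: openT.
- by right; exact: open_C0_lt.
- by right; exact: open_C0_gt.
- by right.
- apply/seteqP; split => x //=; rewrite !in_itv/= andbT => -[/lt_trans xt].
  by move=> /xt; rewrite ltxx.
Qed.

(** Level [0] is the only one at which both the closed sublevel and the
    closed superlevel set may fail to be compact. Since [t < s], either [s] or
    [t] lies on the side of [0] where the complement is compact. *)
Lemma L1D_R1_ge (s t : R) : t < s ->
  fine (mu setT) <= L1 mu f s + R1 mu f t.
Proof.
move=> ts; rewrite -lee_fin EFin_L1D_R1 EFin_ftm_setT.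
have cover : f @^-1` `]-oo, s[ `|` f @^-1` `]t, +oo[ = setT.
  apply/seteqP; split => x //= _; rewrite !in_itv/= andbT.
  by have [fxs|sfx] := ltP (f x) s; [left|right; exact: lt_le_trans sfx].
have oL := open_C0_lt s; have oR := open_C0_gt t.
have [s0|s0] := ltP 0 s.
  by apply: tm_setT_le => //; exact: compact_C0_ge.
rewrite addeC; apply: tm_setT_le => //; last by rewrite setUC.
by apply: compact_C0_le; exact: lt_le_trans s0.
Qed.

Lemma L1_at_right (t : R) :
  L1 mu f s @[s --> t^'+] --> fine (mu setT) + oppR1 mu f t.
Proof.
apply: (@squeeze_cvgr _ _ _ _ (cst (fine (mu setT) + oppR1 mu f t))
  (fun s => fine (mu setT) + oppR1 mu f s)).
- near=> s; have ts : t < s by near: s; exact: nbhs_right_gt.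
  by rewrite /oppR1 /= lerBlDr lerBrDr L1D_R1_ge// L1D_R1_le.
- exact: cvg_cst.
- apply: cvgD; first exact: cvg_cst.
  exact: (cumulative_is_right_continuous (oppR1 mu f)).
Unshelve. all: by end_near. Qed.

End left_right_functions.

Theorem theorem6p9 (R : realType) (X : topologicalType)
    (X_hausdorff : hausdorff_space X)
    (X_locally_compact : locally_compact (@setT X))
    (X_connected : connected (@setT X))
    (mu : finite_topological_measure R X) (f : C0 R X) :
  forall A : set R, measurable A -> right_measure mu f A = left_measure mu f A.
Proof.
apply: (@left_lebesgue_stieltjesE _ (L1_cumulative mu f) (oppR1 mu f)) => t.
exact: L1_at_right.
Qed.
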